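(* For all distributions of $Z$, $\lim_{n\to\infty}H_n=\infty$ almost surely.
   Context: $\mathbb{N}=\{1,2,\ldots\}$. Let $Z,Z_1,Z_2,\ldots$ be independent, identically distributed random variables taking values in $\mathbb{N}$. In the subtractive random forest on vertex set $\mathbb{Z}$, integers $i\le 0$ are roots and each $n\in\mathbb{N}$ is attached by an edge to its parent $n-Z_n$. The height $H_n$ of the forest at time $n$ is the maximum over $t\in\{1,\ldots,n\}$ of the length (number of edges) of the path from $t$ to the root of its tree, i.e. the number of steps of the map $s\mapsto s-Z_s$ needed, starting from $t$, to first reach an integer $\le 0$. *)

(* Defs.v *)
From HB Require Import structures.
From mathcomp Require Import all_boot all_order all_algebra.
From mathcomp Require Import all_classical all_reals all_analysis.

Set Implicit Arguments.
Unset Strict Implicit.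
Unset Printing Implicit Defensive.

Import Order.TTheory GRing.Theory Num.Theory.

Local Open Scope classical_set_scope.
Local Open Scope ring_scope.

(* Mutual independence of the family (X i), i in D: the product rule over
   every finite subfamily. *)
Definition mutually_independent d d' (T : measurableType d)
    (T' : measurableType d') (R : realType) (P : probability T R)
    (I : choiceType) (D : set I) (X : I -> {RV P >-> T'}) : Prop :=
  forall (s : seq I) (A : I -> set T'),
    uniq s -> [set` s] `<=` D -> (forall i, measurable (A i)) ->
    P (\bigcap_(i in [set` s]) X i @^-1` A i) =
    (\prod_(i <- s) P (X i @^-1` A i))%E.

Definition has_distribution d d' (T : measurableType d)
    (T' : measurableType d') (R : realType) (P : probability T R)
    (X : {RV P >-> T'}) (mu : probability T' R) : Prop :=
  forall A : set T', measurable A -> distribution P X A = mu A.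

(* A realization of the forest on the vertex set int is given by z : nat -> nat,
   where z n is the value of Z_n for n >= 1; the value z 0 is never used.
   Roots have no parent; on them the map is extended by the identity. *)
Definition is_root (s : int) : bool := s <= 0.

Definition parent (z : nat -> nat) (s : int) : int :=
  if is_root s then s else s - (z `|s|%N)%:Z.

(* The least k such that k parent steps from t reach a root, searched among
   k <= |t|. When all z n are positive each step decreases a positive vertex
   by at least 1, so this range always contains such a k (depthP). *)
Definition depth (z : nat -> nat) (t : int) : nat :=
  find (fun k => is_root (iter k (parent z) t)) (iota 0 `|t|%N.+1).

Definition height (z : nat -> nat) (n : nat) : nat :=
  \max_(1 <= t < n.+1) depth z t%:Z.

Lemma iter_parent_le (z : nat -> nat) (t : int) (k : nat) :
  (forall n, (0 < n)%N -> (0 < z n)%N) ->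
  is_root (iter k (parent z) t) || (iter k (parent z) t <= t - k%:Z).
Proof.
move=> z0; elim: k => [|k IH] /=; first by rewrite subr0 lexx orbT.
set s := iter k (parent z) t in IH *.
rewrite /parent; case: ifPn => [->//|sN].
rewrite (negbTE sN) /= in IH.
apply/orP; right.
have zs : (0 < z `|s|)%N.
  by apply: z0; rewrite absz_gt0; apply: contraNneq sN => ->; rewrite /is_root.
by rewrite -addn1 PoszD opprD addrA lerB.
Qed.

Lemma depthP (z : nat -> nat) (t : int) :
  (forall n, (0 < n)%N -> (0 < z n)%N) ->
  is_root (iter (depth z t) (parent z) t) /\
  (forall j, (j < depth z t)%N -> ~~ is_root (iter j (parent z) t)).
Proof.
move=> z0; rewrite /depth; set p := fun k => _; set l := iota _ _.
have hp : has p l.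
  apply/hasP; exists `|t|%N; first by rewrite mem_iota add0n leqnn.
  have /orP[//|h] := iter_parent_le t `|t|%N z0.
  by apply: (le_trans h); rewrite subr_le0 abszE ler_norm.
have lt : (find p l < `|t|.+1)%N by move: hp; rewrite has_find size_iota.
split.
  by move: (nth_find 0%N hp); rewrite nth_iota.
move=> j jp; move: (before_find 0%N jp).
by rewrite nth_iota ?(ltn_trans jp)// add0n => /negbT.
Qed.

(* Main.v *)
Require Import Defs.
From HB Require Import structures.
From mathcomp Require Import all_boot all_order all_algebra.
From mathcomp Require Import all_classical all_reals all_analysis.
From mathcomp Require Import ring.

(** Choose a value [k] that [Z] takes with probability [p > 0]; as [Z] is
positive, so is [k]. Cut the multiples of [k] into consecutive blocks of [m].
If all the [Z] in one block equal [k], then the path that starts at the last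
vertex of the block walks back through the whole block before it can meet a
root, so its length is at least [m] ([leq_depth_run]). By independence, every
block has this property with probability [p ^ m > 0], independently of the
other blocks ([probability_runs]), so almost surely some block has it
([probability_avoid_all]). Discarding a null set for every [m], almost surely
the height reaches every [m]; it is nondecreasing, so it tends to infinity. *)

Import Order.TTheory GRing.Theory Num.Theory.
Import numFieldNormedType.Exports.

Local Open Scope classical_set_scope.

Lemma leq_height (z : nat -> nat) (n n' : nat) :
  n <= n' -> height z n <= height z n'.
Proof.
move=> nn'; rewrite /height [leqRHS](big_cat_nat (n := n.+1))//=.
exact: leq_maxl.
Qed.

Lemma depth_le_height (z : nat -> nat) (t n : nat) :
  0 < t <= n -> depth z (Posz t) <= height z n.
Proof.
move=> /andP[t0 tn]; rewrite /height (bigD1_seq t) ?iota_uniq//=.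
  exact: leq_maxl.
by rewrite mem_index_iota t0 ltnS.
Qed.

(** The path from [(a + m) * k] visits [(a + m) * k, (a + m - 1) * k, ...] and
is still at [a * k + k > 0] after [m - 1] steps, hence cannot reach a root in
fewer than [m] steps. *)
Lemma leq_depth_run (z : nat -> nat) (a m k : nat) :
  (forall n, 0 < n -> 0 < z n) -> 0 < k ->
  (forall i, i < m -> z ((a + i).+1 * k) = k) ->
  m <= depth z (Posz ((a + m) * k)).
Proof.
move=> z0 k0 zk; rewrite leqNgt; apply/negP => depth_lt.
have walk i : i <= m ->
    iter i (parent z) (Posz ((a + m) * k)) = Posz ((a + (m - i)) * k).
  elim: i => [|i IHi] im; first by rewrite subn0.
  rewrite iterS IHi ?(ltnW im)//.
  have -> : a + (m - i) = (a + (m - i.+1)).+1 by rewrite -addnS subnSK.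
  rewrite /parent /is_root lez_nat leqn0 muln_eq0 /= (gtn_eqF k0).
  rewrite /= zk; last by rewrite ltn_subLR// addSn ltnS leq_addl.
  by rewrite mulSn PoszD addrC addKr.
have [+ _] := depthP (Posz ((a + m) * k)) z0.
rewrite walk ?(ltnW depth_lt)// /is_root lez_nat leqn0 muln_eq0.
by rewrite (gtn_eqF k0) orbF addn_eq0 subn_eq0 [m <= _]leqNgt depth_lt andbF.
Qed.

Section events.
Context {d : measure_display} {T : measurableType d} {R : realType}.
Variable P : probability T R.

(** Events whose finite intersections obey the product rule have complements
that obey it too, because [P (A `&` ~` E) = P A - P (A `&` E)]. Carrying the
uncomplemented events with indices in [s] is what makes the induction on [N]
go through: the subtracted term has [N :: s] in place of [s]. *)
Lemma probability_avoid_prefix {E : nat -> set T} {q : R} :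
  (forall j, measurable (E j)) ->
  (forall s, uniq s -> P (\bigcap_(j in [set` s]) E j) = (q ^+ size s)%:E) ->
  forall N s, uniq s -> all (leq N) s ->
  P ((\bigcap_(j in `I_N) ~` E j) `&` \bigcap_(j in [set` s]) E j) =
  ((1 - q) ^+ N * q ^+ size s)%:E.
Proof.
move=> mE PE; elim=> [|N IHN] s us sN.
  by rewrite II0 bigcap_set0 setTI PE// expr0 mul1r.
set A := \bigcap_(j in `I_N) ~` E j in IHN *.
set F := \bigcap_(j in [set` s]) E j.
have mA : measurable A.
  by apply: fin_bigcap_measurable => [|j _]; [exact: finite_II|exact: measurableC].
have mF : measurable F by apply: fin_bigcap_measurable.
have -> : (\bigcap_(j in `I_N.+1) ~` E j) `&` F = (A `&` F) `\` E N.
  by rewrite IIS bigcap_setU bigcap_set1 setDE -/A setIAC.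
have -> : P ((A `&` F) `\` E N) = (P (A `&` F) - P (A `&` F `&` E N))%E.
  have mAF : measurable (A `&` F) by exact: measurableI.
  by apply: measureD => //; rewrite (le_lt_trans (probability_le1 _ _)) ?ltry.
have -> : A `&` F `&` E N = A `&` \bigcap_(j in [set` N :: s]) E j.
  by rewrite bigcap_seq big_cons -bigcap_seq -setIA (setIC F).
have sN' : all (leq N) s by apply: sub_all sN => j; exact: ltnW.
have uNs : uniq (N :: s).
  by rewrite /= us andbT; apply/negP => /(allP sN); rewrite ltnn.
rewrite (IHN (N :: s))//= ?leqnn// IHN//.
rewrite -EFinB; congr EFin; rewrite !exprS; ring.
Qed.

(** A Borel-Cantelli statement: the probability of avoiding all the events is
at most [(1 - q) ^+ N] for every [N]. *)
Lemma probability_avoid_all {E : nat -> set T} {q : R} : (0 < q)%R ->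
  (forall j, measurable (E j)) ->
  (forall s, uniq s -> P (\bigcap_(j in [set` s]) E j) = (q ^+ size s)%:E) ->
  P.-negligible (\bigcap_j ~` E j).
Proof.
move=> q0 mE PE.
have mN : measurable (\bigcap_j ~` E j).
  by apply: bigcapT_measurable => j; exact: measurableC.
have q1 : (q <= 1)%R.
  rewrite -lee_fin -[q]expr1 -(PE [:: 0])//; apply: probability_le1.
  exact: fin_bigcap_measurable.
have leN N : (P (\bigcap_j ~` E j) <= ((1 - q) ^+ N)%:E)%E.
  have := probability_avoid_prefix mE PE N [::] isT isT.
  rewrite set_nil bigcap_set0 setIT mulr1 => <-.
  apply: le_measure; rewrite ?inE//; last by move=> w h j _; exact: h.
  by apply: fin_bigcap_measurable => [|j _]; [exact: finite_II|exact: measurableC].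
exists (\bigcap_j ~` E j); split => //.
have fP : P (\bigcap_j ~` E j) \is a fin_num by exact: fin_num_measure.
apply/eqP; rewrite eq_le measure_ge0 andbT -(fineK fP) lee_fin.
have cq : ((1 - q) ^+ n @[n --> \oo] --> (0 : R))%R.
  by apply: cvg_expr; rewrite ger0_norm ?subr_ge0// ltrBlDr ltrDl.
rewrite -(cvg_lim (@Rhausdorff R) cq); apply: limr_ge; first exact: cvgP cq.
by apply: nearW => n; rewrite -lee_fin fineK.
Qed.

End events.

(** By countable additivity, the atoms of [nat] cannot all be null. *)
Lemma probability_atom {R : realType} (mu : probability nat R) :
  exists k, (0 < mu [set k])%E.
Proof.
apply/not_existsP => mu0.
have : mu.-negligible (\bigcup_k [set k]).
  apply: negligible_bigcup => k; exists [set k]; split => //.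
  by apply/eqP; rewrite eq_le measure_ge0 andbT leNgt; apply/negP/mu0.
have -> : \bigcup_k [set k] = [set: nat] by apply/seteqP; split => // k _; exists k.
move=> /(measure_negligible measurableT) muT.
by have /eqP := etrans (esym (probability_setT mu)) muT; rewrite onee_eq0.
Qed.

Section runs.
Context {d : measure_display} {T : measurableType d} {R : realType}.
Variables (P : probability T R) (Z : nat -> {RV P >-> nat}).

(** The [j]-th block starts at [(j * m + 1) * k]: the successor keeps its times
positive, where the [Z n] are identically distributed and independent. *)
Definition run (k m j : nat) : set T :=
  \bigcap_(i in `I_m) Z ((j * m + i).+1 * k) @^-1` [set k].

Lemma measurable_run k m j : measurable (run k m j).
Proof.
apply: fin_bigcap_measurable => [|i _]; first exact: finite_II.
exact: measurable_funPTI.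
Qed.

(** Distinct blocks use distinct times, so that an intersection of runs is a
single product event over [m * size s] independent variables. *)
Lemma probability_runs (k m : nat) (p : R) (s : seq nat) :
  mutually_independent [set n : nat | 0 < n] Z -> 0 < k ->
  (forall n, 0 < n -> P (Z n @^-1` [set k]) = p%:E) -> uniq s ->
  P (\bigcap_(j in [set` s]) run k m j) = ((p ^+ m) ^+ size s)%:E.
Proof.
move=> Zind k0 Zp us.
pose times := [seq ((j * m + i).+1 * k) | j <- s, i <- iota 0 m].
have utimes : uniq times.
  apply: allpairs_uniq => //; first exact: iota_uniq.
  move=> [j i] [j' i'] /allpairsP[[a b] /= [_ + [-> ->]]].
  move=> + /allpairsP[[a' b'] /= [_ + [-> ->]]].
  rewrite !mem_iota !add0n /= => bm b'm /eqP.
  rewrite eqn_pmul2r// eqSS => /eqP e.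
  have m0 : 0 < m by exact: leq_ltn_trans bm.
  have ea : a = a'.
    by have := congr1 (divn^~ m) e; rewrite !divnMDl// !divn_small// !addn0.
  by move: e; rewrite ea => /addnI ->.
have times_pos n : n \in times -> 0 < n.
  by move=> /allpairsP[[a b] /= [_ _ ->]]; rewrite muln_gt0 k0.
have -> : \bigcap_(j in [set` s]) run k m j =
    \bigcap_(n in [set` times]) Z n @^-1` [set k].
  apply/seteqP; split => [w h n|w h j js i im].
    move=> /allpairsP[[a b] /= [sa + ->]].
    by rewrite mem_iota add0n => bm; exact: h.
  by apply: h; apply/allpairsP; exists (j, i); rewrite mem_iota.
rewrite (Zind times (fun=> [set k]))// big_seq.
under eq_bigr do rewrite Zp ?times_pos//.
rewrite -big_seq prodEFin big_const_seq count_predT size_allpairs size_iota.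
by rewrite iter_mulr_1 mulnC exprM.
Qed.

End runs.

Theorem proposition9 (R : realType) (mu : probability nat R)
    (d : measure_display) (T : measurableType d) (P : probability T R)
    (Z : nat -> {RV P >-> nat})
    (Z_pos : forall (n : nat) (w : T), (0 < n)%N -> (0 < Z n w)%N)
    (Z_id : forall n : nat, (0 < n)%N -> has_distribution (Z n) mu)
    (Z_indep : mutually_independent [set n : nat | (0 < n)%N] Z) :
  {ae P, forall w : T, height (fun m => Z m w) n @[n --> \oo] --> \oo}.
Proof.
have [k muk] := probability_atom mu.
pose p := fine (mu [set k]).
have muE : mu [set k] = p%:E by rewrite fineK// fin_num_measure.
have p0 : (0 < p)%R by rewrite -lte_fin -muE.
have Zp n : 0 < n -> P (Z n @^-1` [set k]) = p%:E.
  by move=> n0; rewrite -muE -(Z_id n n0).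
have k0 : 0 < k.
  rewrite lt0n; apply/eqP => k_eq0; move: p0; rewrite -lte_fin -(Zp 1)//.
  rewrite (_ : _ @^-1` _ = set0) ?measure0 ?ltxx//.
  by apply/seteqP; split => // w /=; rewrite k_eq0 => Z0; have := Z_pos 1 w isT; rewrite Z0.
have noruns m : P.-negligible (\bigcap_j ~` run P Z k m j).
  apply: (probability_avoid_all P (q := (p ^+ m)%R)).
  - exact: exprn_gt0.
  - exact: measurable_run.
  - by move=> s us; exact: probability_runs.
apply: negligibleS (negligible_bigcup noruns) => w /=; apply: contra_notP.
move=> hasrun; apply/cvgnyPge => m.
have [j jrun] : exists j, run P Z k m j w.
  apply: contrapT => /forallNP norun; apply: hasrun.
  by exists m => // j _; exact: norun.
(* For [m = 0] the end of the block may be the root [0], which [height]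
   does not count. *)
case: (posnP m) => [->|m0]; first exact: nearW.
exists ((j * m + m) * k) => // n /= tn.
apply: leq_trans (leq_height _ _ _ tn).
apply: leq_trans (depth_le_height _ ((j * m + m) * k) _ _).
  by apply: leq_depth_run => // i; exact: Z_pos.
by rewrite leqnn andbT muln_gt0 addn_gt0 m0 orbT.
Qed.
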